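(* Let $(\boldsymbol{\nu},\mathbf{G},T)$ be a deterministic ($\sigma=0$) instance of Rising Graph-Triggered Bandits with $k$ arms and general connectivity matrix $\mathbf{G}\in\{0,1\}^{k\times k}$, and let $\bar{\mathbf{G}}^L$ be the maximal block sub-matrix of $\mathbf{G}$ used by the algorithm DR-G-UB, with clique partition $\mathcal{C}_{\bar{\mathbf{G}}^L}$. Then DR-G-UB suffers a regret bounded by $$R_{\boldsymbol{\nu},\mathbf{G},T}(\text{DR-G-UB})\le\widetilde{\mathcal{O}}\Bigg(\min_{q\in[0,1]}\Bigg\{T^q\!\!\sum_{C_m^L\in\mathcal{C}_{\bar{\mathbf{G}}^L}}\!\!|C_m^L|\,\Upsilon_{\boldsymbol{\nu}}\Big(\Big\lceil\tfrac{\widetilde N_{C_m^L,T}}{|C_m^L|}\Big\rceil,q\Big)+\!\!\sum_{C_m^L\in\mathcal{C}_{\bar{\mathbf{G}}^L}}\!\!|C_m^L|\,\widetilde N_{C_m^L,T}^{\frac{q}{1+q}}\,\Upsilon_{\boldsymbol{\nu}}\Big(\Big\lceil\tfrac{\widetilde N_{C_m^L,T}}{|C_m^L|}\Big\rceil,q\Big)^{\frac{1}{1+q}}\Bigg\}\Bigg),$$ where $\widetilde N_{C_m^L,T}$ is the number of rounds in which DR-G-UB pulls an arm of $C_m^L$.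
   Context: Graph-Triggered Bandits (GTB): there are $k$ arms, a horizon $T\in\mathbb{N}$, and a symmetric connectivity matrix $\mathbf{G}\in\{0,1\}^{k\times k}$ with $\mathbf{G}_{i,i}=1$ for all $i\in[k]$. At each round $t\in[T]$ the agent selects an arm $I_t$ based on the past history. Let $N_{i,t}=\sum_{\tau\le t}\mathbf{1}\{I_\tau=i\}$ (pulls), $\mathbf{N}_t=(N_{1,t},\dots,N_{k,t})^\top$, and $\widetilde N_{i,t}=\sum_{\tau\le t}\mathbf{1}\{\mathbf{G}_{I_\tau,i}=1\}$ (triggers). In the deterministic case $\sigma=0$ the agent receives exactly $\mu_{I_t}(\widetilde N_{I_t,t})\in[0,1]$. Performance: $J_{\boldsymbol{\nu},\mathbf{G},T}(\pi)=\mathbb{E}[\sum_{t=1}^T\mu_{I_t}(\widetilde N_{I_t,t})]$; regret: $R_{\boldsymbol{\nu},\mathbf{G},T}(\pi)=\sup_{\pi'}J_{\boldsymbol{\nu},\mathbf{G},T}(\pi')-J_{\boldsymbol{\nu},\mathbf{G},T}(\pi)$. Rising: with $\gamma_i(n)=\mu_i(n+1)-\mu_i(n)$, for all $i,n$: $\gamma_i(n)\ge0$ and $\gamma_i(n-1)\ge\gamma_i(n)$. Total increment: $\Upsilon_{\boldsymbol{\nu}}(M,q)=\sum_{t=1}^{M-1}\max_{i\in[k]}\gamma_i(t)^q$. A matrix $\mathbf{H}\in\{0,1\}^{k\times k}$ is block-diagonal if there is a partition $\mathcal{C}_{\mathbf{H}}$ of $[k]$ (its cliques) such that $\mathbf{H}_{i,j}=1$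 iff $i,j$ are in the same class. A block-diagonal $\mathbf{G}^L$ is a block sub-matrix of $\mathbf{G}$ if $\mathbf{G}_{i,j}-\mathbf{G}^L_{i,j}\ge0$ for all $i,j$; it is maximal if it minimizes the number of cliques $|\mathcal{C}_{\mathbf{G}^L}|$ among all block sub-matrices of $\mathbf{G}$. For a clique $C$, $\widetilde N_{C,T}=\sum_{i\in C}N_{i,T}$. Let $t_{i,n}$ be the round at which arm $i$ is pulled for the $n$-th time and $t^{I,L}_{i,n}=\mathbf{e}_i^\top(\bar{\mathbf{G}}^L)^\top\mathbf{N}_{t_{i,n}}$ (number of pulls, up to round $t_{i,n}$, of arms in the clique of $i$ in $\bar{\mathbf{G}}^L$). Algorithm DR-G-UB (input $\mathbf{G}$): compute a maximal block sub-matrix $\bar{\mathbf{G}}^L$; first play each arm twice in round-robin; afterwards at each round $t$ play $I_t\in\arg\max_{i\in[k]}\bar\mu^L_i(t)$ (ties arbitrary), where, writing $N=N_{i,t-1}$, $$\bar\mu^L_i(t)=\mu_i(t^{I,L}_{i,N})+(t-t^{I,L}_{i,N})\frac{\mu_i(t^{I,L}_{i,N})-\mu_i(t^{I,L}_{i,N-1})}{t^{I,L}_{i,N}-t^{I,L}_{i,N-1}}.$$ Notation $f\le\widetilde{\mathcal{O}}(g)$: there are a constant $c$ depending only on $k$ and a universal $p\geq 0$ such that $f\le c\,(1+\log T)^p\,(1+g)$. *)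

(* Defs.v *)
From HB Require Import structures.
From mathcomp Require Import all_boot all_order all_algebra.
From mathcomp Require Import all_classical all_reals all_analysis.

Set Implicit Arguments.
Unset Strict Implicit.
Unset Printing Implicit Defensive.

Import Order.TTheory GRing.Theory Num.Theory.
Local Open Scope ring_scope.

Section Connectivity.
Variable k : nat.
Implicit Types (G H : 'M[bool]_k) (C : {set {set 'I_k}}).

Definition connectivity G : Prop := G^T = G /\ forall i, G i i.

(* [H] is block-diagonal and [C] is its set of cliques. *)
Definition clique_partition H C : Prop :=
  finset.partition C [set: 'I_k] /\
  forall i j, H i j = [exists A in C, (i \in A) && (j \in A)].

Definition block_submatrix G H C : Prop :=
  clique_partition H C /\ forall i j, (H i j <= G i j)%N.

Definition maximal_block_submatrix G H C : Prop :=
  block_submatrix G H C /\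
  forall H' C', block_submatrix G H' C' -> (#|C| <= #|C'|)%N.

End Connectivity.

(* A sequence [s : seq 'I_k] lists the arms played, oldest first: its item of
   index tau is the arm played at round tau + 1, and [take t s] is what has been
   played up to and including round t. *)
Section Counts.
Variable k : nat.
Implicit Types (G H : 'M[bool]_k) (i : 'I_k) (s : seq 'I_k).

Definition pulls i s : nat := count_mem i s.

Definition triggers G i s : nat := count (fun j => G j i) s.

(* The first round by which [i] has been pulled [n] times. *)
Definition pull_time i n s : nat :=
  find (fun t => (n <= pulls i (take t s))%N) (iota 0 (size s).+1).

(* e_i^T H^T N_t with t = [pull_time i n s]. *)
Definition clique_time H i n s : nat :=
  (\sum_(j < k) H j i * pulls j (take (pull_time i n s) s))%N.

Definition clique_pulls (A : {set 'I_k}) s : nat := (\sum_(i in A) pulls i s)%N.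

End Counts.

Section Bandit.
Local Open Scope classical_set_scope.
Variables (R : realType) (k : nat).
Implicit Types (mu : 'I_k -> nat -> R) (G H : 'M[bool]_k) (T : nat).

Definition gain mu i n : R := mu i n.+1 - mu i n.

(* [mu i n] is the reward of arm [i] at its [n]-th trigger, so only n >= 1 is
   meaningful and [mu i 0] is left unconstrained. *)
Definition rising_instance mu : Prop :=
  [/\ forall i n, (0 < n)%N -> 0 <= mu i n <= 1,
      forall i n, (0 < n)%N -> 0 <= gain mu i n &
      forall i n, (1 < n)%N -> gain mu i n <= gain mu i n.-1].

(* Here 0 `^ 0 = 1. Taking 0 instead would not change the infimum over q of
   [regret_bound] below: its value at q = 0 would then be the limit at 0+. *)
Definition total_increment mu (M : nat) (q : R) : R :=
  \sum_(1 <= t < M) \big[Num.max/0]_(i < k) (gain mu i t `^ q).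

(* The (arm, reward) pairs observed so far, oldest first. *)
Definition history := seq ('I_k * R).

(* Pull [i] after [h]; the trigger count includes the current pull. *)
Definition observe mu G (h : history) (i : 'I_k) : history :=
  rcons h (i, mu i (triggers G i (rcons (unzip1 h) i))).

Definition play mu G (s : seq 'I_k) : history := foldl (observe mu G) [::] s.

Definition total_reward (h : history) : R := \sum_(z <- h) z.2.

(* Randomised, history-dependent policies. *)
Definition policies : set (history -> 'I_k -> R) :=
  [set pi | forall h, (forall i, 0 <= pi h i) /\ \sum_(i < k) pi h i = 1].

(* Probability that [pi] plays exactly the arms [s] in the first T rounds. *)
Definition trajectory_prob mu G T (pi : history -> 'I_k -> R)
    (s : T.-tuple 'I_k) : R :=
  \prod_(t < T) pi (play mu G (take t s)) (tnth s t).

Definition expected_reward mu G T (pi : history -> 'I_k -> R) : R :=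
  \sum_(s : T.-tuple 'I_k)
    trajectory_prob mu G pi s * total_reward (play mu G s).

Definition regret mu G T (pi : history -> 'I_k -> R) : R :=
  sup (expected_reward mu G T @` policies) - expected_reward mu G T pi.

Definition deterministic (a : history -> 'I_k) : history -> 'I_k -> R :=
  fun h i => (i == a h)%:R.

Definition run mu G (a : history -> 'I_k) T : history :=
  iter T (fun h => observe mu G h (a h)) [::].

(* The optimistic index of [i] at round t = size s + 1. It evaluates [mu] at
   clique counts in [H], not at the trigger counts in G. *)
Definition optimistic_index mu H (s : seq 'I_k) (i : 'I_k) : R :=
  let N := pulls i s in
  let t := (size s).+1 in
  let x1 := clique_time H i N s in
  let x0 := clique_time H i N.-1 s in
  mu i x1 + (t%:R - x1%:R) * ((mu i x1 - mu i x0) / (x1%:R - x0%:R)).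

(* [a] is DR-G-UB run with the block sub-matrix [H], for some tie-breaking. *)
Definition DR_G_UB mu H (a : history -> 'I_k) : Prop :=
  forall h : history,
    ((size h < 2 * k)%N -> a h = (size h %% k)%N :> nat) /\
    ((2 * k <= size h)%N -> forall i,
       optimistic_index mu H (unzip1 h) i
         <= optimistic_index mu H (unzip1 h) (a h)).

(* [s] lists the arms played over the whole horizon, so T = size s. *)
Definition regret_bound mu (C : {set {set 'I_k}}) (s : seq 'I_k) (q : R) : R :=
  let Upsilon (A : {set 'I_k}) :=
    total_increment mu
      `|Num.ceil ((clique_pulls A s)%:R / #|A|%:R : R)|%N q in
  (size s)%:R `^ q * (\sum_(A in C) #|A|%:R * Upsilon A)
  + \sum_(A in C) #|A|%:R * (clique_pulls A s)%:R `^ (q / (1 + q))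
                          * Upsilon A `^ (1 + q)^-1.

End Bandit.

(* Main.v *)
(* By concavity the optimistic index of an arm dominates its reward at time t, so
   the regret of a round t > 2k is at most min(1, T * gamma_i(x0)), where i is
   the arm played and x0 the clique count at its second last pull; this is at
   most T^q * gamma_i(x0)^q. Inside a clique A the counts x0 of different rounds
   are distinct, so the total over A is at most T^q times the sum of the first
   clique_pulls A - 2|A| values of the nonincreasing sequence
   max_i gamma_i(n)^q, hence at most
   T^q * |A| * Upsilon(ceil(clique_pulls A / |A|), q). So the first term of the bound
   alone suffices, with c = 2k and p = 0. *)
Require Import Defs.
From HB Require Import structures.
From mathcomp Require Import all_boot all_order all_algebra.
From mathcomp Require Import all_classical all_reals all_analysis.
From mathcomp Require Import zify.
Import Order.TTheory GRing.Theory Num.Theory.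
Local Open Scope classical_set_scope.
Local Open Scope ring_scope.

(** * Pull times and clique counts along a sequence of pulls *)

Section PullTimes.
Set Implicit Arguments.
Unset Strict Implicit.
Variable k : nat.
Implicit Types (G H : 'M[bool]_k) (i j : 'I_k) (s : seq 'I_k).

Lemma pulls_rcons i s j : pulls i (rcons s j) = (pulls i s + (j == i))%N.
Proof. by rewrite /pulls -cats1 count_cat /= addn0. Qed.

Lemma triggers_rcons H i s j :
  triggers H i (rcons s j) = (triggers H i s + H j i)%N.
Proof. by rewrite /triggers -cats1 count_cat /= addn0. Qed.

(** Double counting: pulls grouped by arm on the left, taken round by round on the right. This turns
    the matrix product in [clique_time] into a count over a prefix of [s]. *)
Lemma sum_pulls_triggers H i s :
  (\sum_(j < k) H j i * pulls j s)%N = triggers H i s.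
Proof.
elim/last_ind: s => [|s l IHs].
  by rewrite big1 // => j _; rewrite muln0.
rewrite triggers_rcons -IHs.
under eq_bigr => j _ do rewrite pulls_rcons mulnDr.
rewrite big_split /=; congr addn.
rewrite (bigD1 l) //= eqxx muln1 big1 ?addn0 // => j /negPf.
by rewrite eq_sym => ->; rewrite muln0.
Qed.

Lemma clique_timeE H i n s :
  clique_time H i n s = triggers H i (take (pull_time i n s) s).
Proof. exact: sum_pulls_triggers. Qed.

Lemma pull_time_has i n s : (n <= pulls i s)%N ->
  has (fun t => (n <= pulls i (take t s))%N) (iota 0 (size s).+1).
Proof.
move=> le_n; apply/hasP; exists (size s); last by rewrite take_size.
by rewrite mem_iota /= add0n.
Qed.

Lemma pull_time_size i n s : (n <= pulls i s)%N -> (pull_time i n s <= size s)%N.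
Proof. by move/pull_time_has; rewrite has_find size_iota. Qed.

Lemma iota_rcons m n : iota m n.+1 = rcons (iota m n) (m + n)%N.
Proof. by rewrite -addn1 iotaD cats1. Qed.

Lemma find_take_rcons i n s j :
  find (fun t => (n <= pulls i (take t (rcons s j)))%N) (iota 0 (size s).+1)
  = find (fun t => (n <= pulls i (take t s))%N) (iota 0 (size s).+1).
Proof.
apply: eq_in_find => t; rewrite mem_iota /= add0n ltnS => le_t.
by rewrite -cats1 takel_cat.
Qed.

(** Extending the play only appends a later candidate to the search, which already succeeds before
    it. *)
Lemma pull_time_rcons i n s j : (n <= pulls i s)%N ->
  pull_time i n (rcons s j) = pull_time i n s.
Proof.
move=> le_n; rewrite /pull_time size_rcons iota_rcons.
rewrite -[rcons (iota _ _) _]cats1 find_cat.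
rewrite find_take_rcons.
suff -> : has (fun t => (n <= pulls i (take t (rcons s j)))%N)
              (iota 0 (size s).+1) by [].
by rewrite has_find find_take_rcons -has_find pull_time_has.
Qed.

Lemma pull_time_new i s : pull_time i (pulls i s).+1 (rcons s i) = (size s).+1.
Proof.
rewrite /pull_time size_rcons iota_rcons -[rcons (iota _ _) _]cats1 find_cat.
have /negPf -> : ~~ has (fun t => (pulls i s < pulls i (take t (rcons s i)))%N)
                        (iota 0 (size s).+1).
  rewrite has_find find_take_rcons -has_find; apply/hasPn => t _.
  by rewrite -leqNgt /pulls -{2}(cat_take_drop t s) count_cat leq_addr.
by rewrite size_iota /= add0n take_oversize ?size_rcons // pulls_rcons eqxx addn1
  ltnSn addn0.
Qed.

Lemma clique_time_rcons H i n s j : (n <= pulls i s)%N ->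
  clique_time H i n (rcons s j) = clique_time H i n s.
Proof.
move=> le_n; rewrite !clique_timeE pull_time_rcons // -cats1 takel_cat //.
exact: pull_time_size.
Qed.

Lemma clique_time_new H i s : H i i ->
  clique_time H i (pulls i s).+1 (rcons s i) = (triggers H i s).+1.
Proof.
move=> Hii; rewrite clique_timeE pull_time_new take_oversize ?size_rcons //.
by rewrite triggers_rcons Hii addn1.
Qed.

Lemma clique_time_triggers H i n s :
  (clique_time H i n s <= triggers H i s)%N.
Proof.
rewrite clique_timeE; move: (pull_time i n s) => p.
by rewrite /triggers -{2}(cat_take_drop p s) count_cat leq_addr.
Qed.

(** Induction on the last pull. Either the [n]-th pull is older and both times are unchanged, or it
    is the last one: it counts itself through [H i i], so its time exceeds every count reached
    before. *)
Lemma clique_time_ltn H i m n s : H i i ->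
  (m < n)%N -> (n <= pulls i s)%N ->
  (clique_time H i m s < clique_time H i n s)%N.
Proof.
move=> Hii lt_mn; elim/last_ind: s => [|s j IHs]; first by case: n lt_mn.
rewrite pulls_rcons => le_n; have [le_ns|lt_sn] := leqP n (pulls i s).
  by rewrite !clique_time_rcons ?IHs // (leq_trans _ le_ns) // ltnW.
have eji : j = i by apply/eqP; case: eqP le_n => // _; lia.
move: le_n; rewrite eji eqxx addn1 => le_n.
have En : n = (pulls i s).+1 by lia.
rewrite En clique_time_new // ltnS clique_time_rcons; last by lia.
exact: clique_time_triggers.
Qed.

Lemma clique_time_gt0 H i n s : H i i -> (0 < n)%N -> (n <= pulls i s)%N ->
  (0 < clique_time H i n s)%N.
Proof. by move=> *; apply: leq_ltn_trans (clique_time_ltn (m := 0) _ _ _). Qed.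

Lemma clique_pulls_rcons (A : {set 'I_k}) s j :
  clique_pulls A (rcons s j) = (clique_pulls A s + (j \in A))%N.
Proof.
rewrite /clique_pulls; under eq_bigr => i _ do rewrite pulls_rcons.
rewrite big_split /=; congr addn.
have [jA|jA] := boolP (j \in A).
  rewrite (bigD1 j) //= eqxx big1 // => i /andP[_ /negPf].
  by rewrite eq_sym => ->.
rewrite big1 // => i iA; case: eqP => // eji; by rewrite eji iA in jA.
Qed.

(** Cliques are disjoint, so the one witnessing [H j i] must be the one containing [i]. *)
Lemma clique_partitionP H (C : {set {set 'I_k}}) (A : {set 'I_k}) i j :
  clique_partition H C -> A \in C -> i \in A -> H j i = (j \in A).
Proof.
move=> [/and3P[_ triv _] HE] AC iA; rewrite HE; apply/exists_inP/idP.
  move=> [B BC /andP[jB iB]].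
  by rewrite -(def_pblock triv AC iA) (def_pblock triv BC iB).
by move=> jA; exists A => //; rewrite jA.
Qed.

Lemma triggers_clique H (C : {set {set 'I_k}}) (A : {set 'I_k}) i s :
  clique_partition H C -> A \in C -> i \in A ->
  triggers H i s = clique_pulls A s.
Proof.
move=> HC AC iA; elim/last_ind: s => [|s j IHs].
  by rewrite /clique_pulls big1.
by rewrite triggers_rcons clique_pulls_rcons IHs (clique_partitionP _ HC AC iA).
Qed.

Lemma clique_partition_refl H (C : {set {set 'I_k}}) i :
  clique_partition H C -> H i i.
Proof.
move=> HC; have [/and3P[/eqP cov _ _] _] := HC.
have iC : i \in finset.cover C by rewrite cov inE.
have := finset.pblock_mem iC; rewrite -finset.mem_pblock in iC => AC.
by rewrite (clique_partitionP _ HC AC iC).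
Qed.

(* The clique times of the arms of a clique enumerate 1, .., clique_pulls. *)
Lemma sum_clique_time (V : zmodType) (f : nat -> V) H (C : {set {set 'I_k}})
    (A : {set 'I_k}) s :
  clique_partition H C -> A \in C ->
  \sum_(i in A) \sum_(1 <= n < (pulls i s).+1) f (clique_time H i n s)
  = \sum_(1 <= n < (clique_pulls A s).+1) f n.
Proof.
move=> HC AC; elim/last_ind: s => [|s j IHs].
  have -> : clique_pulls A [::] = 0%N by rewrite /clique_pulls big1.
  by rewrite [RHS]big_geq // big1 // => i _; rewrite big_geq.
have same i : i != j ->
    \sum_(1 <= n < (pulls i (rcons s j)).+1) f (clique_time H i n (rcons s j))
    = \sum_(1 <= n < (pulls i s).+1) f (clique_time H i n s).
  rewrite pulls_rcons eq_sym => /negPf ->; rewrite addn0.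
  by apply: eq_big_nat => n /andP[_ ?]; rewrite clique_time_rcons.
rewrite clique_pulls_rcons; have [jA|jA] := boolP (j \in A); last first.
  rewrite addn0 -IHs; apply: eq_bigr => i iA; apply: same.
  by apply: contraNneq jA => <-.
rewrite addn1 big_nat_recr //= -IHs.
rewrite (bigD1 j) //= [in RHS](bigD1 j) //=.
rewrite pulls_rcons eqxx addn1 big_nat_recr //=.
rewrite clique_time_new ?(clique_partition_refl _ HC) //.
rewrite (triggers_clique _ HC AC jA) -addrA -[RHS]addrA; congr (_ + _).
  by apply: eq_big_nat => n /andP[_ ?]; rewrite clique_time_rcons.
by rewrite addrC; congr (_ + _); apply: eq_bigr => i /andP[_ /same].
Qed.

End PullTimes.

(** * Rising rewards: concavity, optimistic indices and sums of gains *)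

Section Rising.
Set Implicit Arguments.
Unset Strict Implicit.
Variables (R : realType) (k : nat) (mu : 'I_k -> nat -> R).
Hypothesis rise : rising_instance mu.
Implicit Types (G H : 'M[bool]_k) (i j : 'I_k) (s : seq 'I_k) (q : R).

Lemma gain_nonincreasing i m n : (0 < m <= n)%N -> gain mu i n <= gain mu i m.
Proof.
have [_ _ dec] := rise; case/andP=> m0; elim: n => [|n IHn].
  by rewrite leqn0 => /eqP->.
rewrite leq_eqVlt => /predU1P[<- //|lt_mn]; apply: le_trans (IHn lt_mn).
by apply: dec; lia.
Qed.

Lemma gain_ge0 i n : (0 < n)%N -> 0 <= gain mu i n.
Proof. by have [_ + _] := rise; apply. Qed.

Lemma mu_nondecreasing i m n : (0 < m <= n)%N -> mu i m <= mu i n.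
Proof.
case/andP=> m0; elim: n => [|n IHn]; first by rewrite leqn0 => /eqP->.
rewrite leq_eqVlt => /predU1P[<- //|lt_mn]; apply: le_trans (IHn lt_mn) _.
by rewrite -subr_ge0 gain_ge0 //; lia.
Qed.

(** Concavity: the increments from [m] on telescope and none exceeds the first. *)
Lemma mu_le_tangent i m n : (0 < m <= n)%N ->
  mu i n - mu i m <= (n%:R - m%:R) * gain mu i m.
Proof.
case/andP=> m0 le_mn; rewrite -(telescope_sumr (mu i)) // -natrB // mulr_natl.
rewrite -sumr_const_nat; apply: ler_sum_nat => j /andP[le_mj _].
by apply: gain_nonincreasing; rewrite m0.
Qed.

Lemma mu_ge_chord i m n p : (0 < m <= n)%N -> (n <= p)%N ->
  (n%:R - m%:R) * gain mu i p <= mu i n - mu i m.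
Proof.
case/andP=> m0 le_mn le_np; rewrite -(telescope_sumr (mu i)) // -natrB //.
rewrite mulr_natl -sumr_const_nat; apply: ler_sum_nat => j /andP[le_mj lt_jn].
by apply: gain_nonincreasing; lia.
Qed.

(** The index extrapolates the chord over the last two pulls of [i]. Its slope is at least the gain
    at the right end [x1], so the line stays above the tangent at [x1], which dominates [mu i]. *)
Lemma optimistic_index_ge H s i : H i i -> (1 < pulls i s)%N ->
  mu i (size s).+1 <= optimistic_index mu H s i.
Proof.
move=> Hii pi; rewrite /optimistic_index.
have lt_x : (clique_time H i (pulls i s).-1 s < clique_time H i (pulls i s) s)%N.
  by apply: clique_time_ltn => //; lia.
have x0_gt0 : (0 < clique_time H i (pulls i s).-1 s)%N.
  by apply: clique_time_gt0 => //; lia.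
have x1_le : (clique_time H i (pulls i s) s <= size s)%N.
  exact: leq_trans (clique_time_triggers _ _ _ _) (count_size _ _).
move: (clique_time _ _ _ _) (clique_time _ _ _ _) lt_x x0_gt0 x1_le.
move=> x1 x0 lt_x x0_gt0 x1_le.
have tan : mu i (size s).+1 - mu i x1
    <= ((size s).+1%:R - x1%:R) * gain mu i x1 by apply: mu_le_tangent; lia.
rewrite -lerBlDl; apply: le_trans tan _; apply: ler_wpM2l.
  by rewrite subr_ge0 ler_nat leqW.
rewrite ler_pdivlMr ?subr_gt0 ?ltr_nat // mulrC.
by apply: mu_ge_chord => //; rewrite x0_gt0 ltnW.
Qed.

(** The chord slope is at most the gain at the left end [x0]. Here [n] stands for the true trigger
    count: being at least [x1], it makes the reward received no smaller than the value from which
    the index starts. *)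
Lemma optimistic_index_le H s i n : H i i -> (1 < pulls i s)%N ->
  (clique_time H i (pulls i s) s <= n)%N ->
  optimistic_index mu H s i - mu i n
    <= (size s).+1%:R * gain mu i (clique_time H i (pulls i s).-1 s).
Proof.
move=> Hii pi; rewrite /optimistic_index.
have lt_x : (clique_time H i (pulls i s).-1 s < clique_time H i (pulls i s) s)%N.
  by apply: clique_time_ltn => //; lia.
have x0_gt0 : (0 < clique_time H i (pulls i s).-1 s)%N.
  by apply: clique_time_gt0 => //; lia.
have x1_le : (clique_time H i (pulls i s) s <= size s)%N.
  exact: leq_trans (clique_time_triggers _ _ _ _) (count_size _ _).
move: (clique_time _ _ _ _) (clique_time _ _ _ _) lt_x x0_gt0 x1_le.
move=> x1 x0 lt_x x0_gt0 x1_le le_n.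
have mu_le : mu i x1 <= mu i n by apply: mu_nondecreasing; lia.
rewrite lerBlDl; apply: lerD => //.
have g0 : 0 <= gain mu i x0 by exact: gain_ge0.
apply: (@le_trans _ _ (((size s).+1%:R - x1%:R) * gain mu i x0)).
  apply: ler_wpM2l; first by rewrite subr_ge0 ler_nat leqW.
  rewrite ler_pdivrMr ?subr_gt0 ?ltr_nat // mulrC.
  by apply: mu_le_tangent; rewrite x0_gt0 ltnW.
by apply: ler_wpM2r => //; rewrite gerBl.
Qed.

(** The summand of [total_increment], named so that its monotonicity in [n] can be stated. *)
Definition max_gain q n : R := \big[Num.max/0]_(i < k) (gain mu i n `^ q).

Lemma max_gain_ge0 q n : 0 <= max_gain q n.
Proof. exact: bigmax_ge_id. Qed.

Lemma max_gain_nonincreasing q m n : 0 <= q ->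
  (0 < m <= n)%N -> max_gain q n <= max_gain q m.
Proof.
move=> q0 /andP[m0 le_mn]; apply: le_bigmax2 => i _.
apply: ge0_ler_powR => //; rewrite ?nnegrE ?gain_ge0 ?(leq_trans m0) //.
by apply: gain_nonincreasing; rewrite m0.
Qed.

(** Interpolation: for [y] below 1 the power only enlarges [y], and above 1 it is at least 1. This
    combines the trivial bound 1 on a round with the gain bound, for every [q]. *)
Lemma le_powR_min x y q : 0 <= q <= 1 -> 0 <= y -> x <= 1 -> x <= y ->
  x <= y `^ q.
Proof.
case/andP=> q0 q1; rewrite le_eqVlt => /predU1P[<- _ x0|y0 x1 le_xy].
  exact: le_trans x0 (powR_ge0 _ _).
have [y1|/ltW y1] := leP y 1.
  by apply: le_trans le_xy _; apply: ger1_powR; rewrite ?y0.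
by apply: le_trans x1 _; rewrite -(powRr0 y) ler_powR.
Qed.

(** Stands in for an optimal policy: at round [n] no arm has more than [n] triggers, so no reward
    exceeds this value. *)
Definition best_mu n : R := \big[Num.max/0]_(i < k) mu i n.

Lemma total_reward_observe G (h : history R k) i :
  total_reward (observe mu G h i)
  = total_reward h + mu i (triggers G i (rcons (unzip1 h) i)).
Proof. by rewrite /total_reward /observe -cats1 big_cat /= big_seq1. Qed.

Lemma unzip1_observe G (h : history R k) i :
  unzip1 (observe mu G h i) = rcons (unzip1 h) i.
Proof. by rewrite /unzip1 map_rcons. Qed.

Lemma play_rcons G s i : play mu G (rcons s i) = observe mu G (play mu G s) i.
Proof. by rewrite /play foldl_rcons. Qed.

Lemma unzip1_play G s : unzip1 (play mu G s) = s.
Proof.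
by elim/last_ind: s => // s i IHs; rewrite play_rcons unzip1_observe IHs.
Qed.

(** * Rewards collected along a fixed sequence of pulls *)

Section Connected.
Variable G : 'M[bool]_k.
Hypothesis G_conn : connectivity G.

Lemma triggers_pulled i s : (0 < triggers G i (rcons s i) <= (size s).+1)%N.
Proof.
rewrite triggers_rcons (proj2 G_conn) addn1 /= ltnS; exact: count_size.
Qed.

Lemma reward01 i s : 0 <= mu i (triggers G i (rcons s i)) <= 1.
Proof.
by have [+ _ _] := rise; apply; have /andP[] := triggers_pulled i s.
Qed.

Lemma total_reward_play_ge0 s : 0 <= total_reward (play mu G s).
Proof.
elim/last_ind: s => [|s i IHs]; first by rewrite /total_reward big_nil.
have /andP[r0 _] := reward01 i s.
by rewrite play_rcons total_reward_observe unzip1_play addr_ge0.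
Qed.

Lemma total_reward_play_le s :
  total_reward (play mu G s) <= \sum_(1 <= n < (size s).+1) best_mu n.
Proof.
elim/last_ind: s => [|s i IHs]; first by rewrite /total_reward big_nil big_geq.
rewrite play_rcons total_reward_observe unzip1_play size_rcons big_nat_recr //=.
apply: lerD IHs _; apply: (bigmax_sup i) => //.
exact: mu_nondecreasing (triggers_pulled i s).
Qed.

End Connected.

(** Cut the range into blocks of length [m]. Every index in the block after [m * M] is at least
    [M.+1], so each of its terms is at most [f M.+1]. *)
Lemma sum_le_block (f : nat -> R) m M : (0 < m)%N ->
  (forall p n, (0 < p <= n)%N -> f n <= f p) ->
  \sum_(1 <= n < (m * M).+1) f n <= m%:R * \sum_(1 <= n < M.+1) f n.
Proof.
move=> m0 dec; elim: M => [|M IHM]; first by rewrite muln0 !big_geq ?mulr0.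
rewrite (@big_cat_nat _ _ _ (m * M).+1) ?ltnS ?leq_pmul2l //=.
rewrite [in leRHS]big_nat_recr //= mulrDr; apply: lerD => //.
apply: (@le_trans _ _ (\sum_((m * M).+1 <= n < (m * M.+1).+1) f M.+1)).
  apply: ler_sum_nat => n /andP[lt_n _]; apply: dec => /=.
  exact: leq_ltn_trans (leq_pmull M m0) lt_n.
by rewrite sumr_const_nat subSS mulnS addnK mulr_natl.
Qed.

(* Compare with [f n = phi (minn n M)]: one of the two omitted pulls of each arm
   contributes at least [phi M], which pays for the missing term [n = M]. *)
Lemma sum_clique_time_le (phi : nat -> R) H (C : {set {set 'I_k}})
    (A : {set 'I_k}) s M :
  (forall n, 0 <= phi n) ->
  (forall p n, (0 < p <= n)%N -> phi n <= phi p) ->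
  clique_partition H C -> A \in C ->
  (forall i, i \in A -> (1 < pulls i s)%N) ->
  (0 < #|A|)%N -> (0 < M)%N -> (clique_pulls A s <= #|A| * M)%N ->
  \sum_(i in A) \sum_(1 <= n < (pulls i s).-1) phi (clique_time H i n s)
    <= #|A|%:R * \sum_(1 <= n < M) phi n.
Proof.
move=> phi0 dec HC AC ps A0 M0 le_A; pose f n := phi (minn n M).
have arm i : i \in A ->
    \sum_(1 <= n < (pulls i s).-1) phi (clique_time H i n s) + phi M
    <= \sum_(1 <= n < (pulls i s).+1) f (clique_time H i n s).
  move=> iA; have pi := ps i iA; have Hii := clique_partition_refl i HC.
  have ct0 n : (0 < n < (pulls i s).+1)%N -> (0 < clique_time H i n s)%N.
    by move=> /andP[? ?]; apply: clique_time_gt0.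
  rewrite [leRHS](@big_cat_nat _ _ _ (pulls i s).-1) /=; [|lia|lia].
  apply: lerD.
    apply: ler_sum_nat => n n_lt; have := ct0 n.
    by move=> H0; apply: dec; lia.
  rewrite big_ltn; last by lia.
  rewrite -[leLHS]addr0; apply: lerD; last by apply: sumr_ge0 => *; apply: phi0.
  by have := ct0 (pulls i s).-1; move=> H0; apply: dec; lia.
have fdec p n : (0 < p <= n)%N -> f n <= f p by move=> ?; apply: dec; lia.
have := ler_sum (index_enum 'I_k) arm.
rewrite big_split /= sumr_const (sum_clique_time f _ HC AC) => leA.
have le1 : \sum_(1 <= n < (clique_pulls A s).+1) f n
    <= \sum_(1 <= n < (#|A| * M).+1) f n.
  rewrite [leRHS](@big_cat_nat _ _ _ (clique_pulls A s).+1) //= lerDl.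
  by apply: sumr_ge0 => *; apply: phi0.
have := le_trans leA (le_trans le1 (sum_le_block M A0 fdec)).
rewrite big_nat_recr //= mulrDr {2}/f minnn -[phi M *+ _]mulr_natl lerD2r.
suff -> : \sum_(1 <= n < M) f n = \sum_(1 <= n < M) phi n by [].
by apply: eq_big_nat => n /andP[_ /ltnW le_n]; rewrite /f; congr phi; lia.
Qed.

End Rising.

(** * Randomised policies, runs of a deterministic rule, and regret *)

Section Policies.
Set Implicit Arguments.
Unset Strict Implicit.
Variables (R : realType) (k : nat) (mu : 'I_k -> nat -> R).
Implicit Types (G H : 'M[bool]_k) (i j : 'I_k) (s : seq 'I_k) (q : R).
Implicit Types (T : nat) (a : history R k -> 'I_k).

(** Conditioning on the first item [x] leaves the same statement for the rule [fun s => f (x :: s)];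
    hence the induction generalises [f]. *)
Lemma sum_prod_take_tnth (I : finType) (f : seq I -> I -> R) T :
  (forall s : seq I, \sum_i f s i = 1) ->
  \sum_(s : T.-tuple I) \prod_(t < T) f (take t s) (tnth s t) = 1.
Proof.
elim: T f => [|T IHT] f f1.
  under eq_bigr => s _ do rewrite big_ord0.
  by rewrite sumr_const card_tuple expn0.
rewrite (reindex (fun p : I * T.-tuple I => [tuple of p.1 :: p.2])) /=.
  transitivity (\sum_x \sum_(s : T.-tuple I)
      \prod_(t < T.+1) f (take t (x :: s)) (tnth [tuple of x :: s] t)).
    by rewrite pair_bigA.
  rewrite -[RHS](f1 [::]); apply: eq_bigr => x _.
  under eq_bigr => s _ do (rewrite big_ord_recl /= tnth0;
    under eq_bigr => t _ do rewrite tnthS).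
  rewrite -mulr_sumr -[RHS]mulr1; congr (_ * _).
  by apply: (IHT (fun s : seq I => f (x :: s))) => s.
exists (fun s : T.+1.-tuple I => (thead s, [tuple of behead s])) => [[x s]|s] _.
  by congr (_, _); apply: val_inj.
by rewrite -tuple_eta.
Qed.

Lemma sum_trajectory_prob G T (pi : history R k -> 'I_k -> R) :
  policies pi -> \sum_(s : T.-tuple 'I_k) trajectory_prob mu G pi s = 1.
Proof.
move=> pol.
by apply: (sum_prod_take_tnth (f := fun s => pi (play mu G s))) => s;
  case: (pol (play mu G s)).
Qed.

Lemma trajectory_prob_ge0 G T (pi : history R k -> 'I_k -> R)
    (s : T.-tuple 'I_k) :
  policies pi -> 0 <= trajectory_prob mu G pi s.
Proof.
by move=> pol; apply: prodr_ge0 => t _; case: (pol (play mu G (take t s))).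
Qed.

Lemma policies_deterministic a : policies (deterministic a).
Proof.
move=> h; split=> [i|]; first by rewrite ler0n.
rewrite (bigD1 (a h)) //= big1 /deterministic ?eqxx ?addr0 // => i /negPf.
by move=> ->.
Qed.

Lemma run_recr G a T :
  run mu G a T.+1 = observe mu G (run mu G a T) (a (run mu G a T)).
Proof. by []. Qed.

Lemma size_run G a T : size (run mu G a T) = T.
Proof. by elim: T => //= T IHT; rewrite /observe size_rcons IHT. Qed.

Lemma size_unzip1_run G a T : size (unzip1 (run mu G a T)) = T.
Proof. by rewrite size_map size_run. Qed.

Lemma play_run G a T : play mu G (unzip1 (run mu G a T)) = run mu G a T.
Proof.
by elim: T => // T IHT; rewrite run_recr unzip1_observe play_rcons IHT.
Qed.

Lemma take_run G a t T : (t <= T)%N ->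
  take t (unzip1 (run mu G a T)) = unzip1 (run mu G a t).
Proof.
elim: T => [|T IHT]; first by rewrite leqn0 => /eqP->.
rewrite leq_eqVlt => /predU1P[->|le_tT].
  by rewrite take_oversize ?size_unzip1_run.
by rewrite run_recr unzip1_observe -cats1 takel_cat ?size_unzip1_run // IHT.
Qed.

Lemma nth_run G a t T i0 : (t < T)%N ->
  nth i0 (unzip1 (run mu G a T)) t = a (run mu G a t).
Proof.
move=> lt_tT; rewrite -(nth_take i0 (ltnSn t)) take_run // run_recr.
by rewrite unzip1_observe nth_rcons size_unzip1_run ltnn eqxx.
Qed.

Hypothesis rise : rising_instance mu.

Lemma expected_reward_le G T (pi : history R k -> 'I_k -> R) :
  connectivity G -> policies pi ->
  expected_reward mu G T pi <= \sum_(1 <= n < T.+1) best_mu mu n.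
Proof.
move=> G_conn pol; rewrite -[leRHS]mul1r -(sum_trajectory_prob G T pol) mulr_suml.
apply: ler_sum => s _; apply: ler_wpM2l; first exact: trajectory_prob_ge0.
by apply: le_trans (total_reward_play_le rise G_conn s) _; rewrite size_tuple.
Qed.

(** The run is one of the trajectories and has probability one; the others contribute nonnegative
    terms, which a lower bound may drop. *)
Lemma expected_reward_run_le G T a : connectivity G ->
  total_reward (run mu G a T) <= expected_reward mu G T (deterministic a).
Proof.
move=> G_conn; have sT : size (unzip1 (run mu G a T)) == T.
  by rewrite size_unzip1_run.
rewrite /expected_reward (bigD1 (Tuple sT)) //= play_run.
rewrite /trajectory_prob big1 => [|t _]; last first.
  (* [a [::]] is a mere default for [nth]. Replaying a prefix of the run gives the history on which
     [a] chose, so each factor is 1. *)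
  rewrite (tnth_nth (a [::])) /= nth_run // take_run ?play_run 1?ltnW //.
  by rewrite /deterministic eqxx.
rewrite mul1r lerDl; apply: sumr_ge0 => s _; apply: mulr_ge0.
  exact: (trajectory_prob_ge0 _ _ (@policies_deterministic a)).
exact: total_reward_play_ge0.
Qed.

Lemma regret_le G T a : connectivity G ->
  regret mu G T (deterministic a)
    <= \sum_(1 <= n < T.+1) best_mu mu n - total_reward (run mu G a T).
Proof.
move=> G_conn; apply: lerB; last exact: expected_reward_run_le.
(* The supremum is over a nonempty set because [a] itself is a competitor. *)
apply: ge_sup; first by eexists; exists (deterministic a) => //;
  exact: policies_deterministic.
by move=> _ [pi pol <-]; exact: expected_reward_le.
Qed.

Lemma best_mu_le1 n : (0 < n)%N -> best_mu mu n <= 1.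
Proof.
have [mu01 _ _] := rise; move=> n0.
by apply: bigmax_le => // i _; case/andP: (mu01 i n n0).
Qed.

(** Trivial bound of 1 per round, for the round-robin phase and for horizons ending within it. *)
Lemma run_regret_le_horizon G T a : connectivity G ->
  \sum_(1 <= n < T.+1) best_mu mu n - total_reward (run mu G a T) <= T%:R.
Proof.
move=> G_conn; rewrite -play_run lerBlDr -[leLHS]addr0; apply: lerD.
  have -> : T%:R = \sum_(1 <= n < T.+1) 1 :> R by rewrite sumr_const_nat subn1.
  apply: ler_sum_nat => n /andP[n0 _].
  exact: best_mu_le1.
exact: total_reward_play_ge0.
Qed.

(** * Regret analysis of DR-G-UB *)

Section Algorithm.
Variables (G H : 'M[bool]_k) (C : {set {set 'I_k}}) (a : history R k -> 'I_k).
Hypothesis G_conn : connectivity G.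
Hypothesis GHC : block_submatrix G H C.
Hypothesis alg : DR_G_UB mu H a.
Local Notation arms t := (unzip1 (run mu G a t)).

(** Arm [i] is due after [i] and after [i + k] rounds; the two booleans record which of these pulls
    have been made. *)
Lemma round_robin_pulls i t : (t <= 2 * k)%N ->
  ((i < t) + (i + k < t) <= pulls i (arms t))%N.
Proof.
elim: t => // t IHt lt_t; have IH := IHt (ltnW lt_t).
rewrite run_recr unzip1_observe pulls_rcons.
have [/(_ _)] := alg (run mu G a t); rewrite size_run => /(_ lt_t) at_ _.
have lt_ik := ltn_ord i.
suff : ((i < t.+1) + (i + k < t.+1)
          <= (i < t) + (i + k < t) + (a (run mu G a t) == i))%N.
  by move=> h; apply: leq_trans h _; rewrite leq_add2r.
rewrite -val_eqE /= at_; have [lt_tk|le_kt] := ltnP t k.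
  by rewrite modn_small //; lia.
have -> : (t %% k)%N = (t - k)%N.
  by rewrite -{1}(subnK le_kt) modnDr modn_small //; lia.
by lia.
Qed.

Lemma pulls_gt1 i t : (2 * k <= t)%N -> (1 < pulls i (arms t))%N.
Proof.
move=> le_kt; have lt_ik := ltn_ord i.
have le2 : (1 < pulls i (arms (2 * k)))%N.
  by apply: leq_trans (round_robin_pulls i (leqnn _)); lia.
apply: leq_trans le2 _; rewrite -(take_run G a le_kt) /pulls.
by rewrite -{2}(cat_take_drop (2 * k) (arms t)) count_cat leq_addr.
Qed.

(** Here [H] lying below [G] enters: a pull counted through [H] is also a trigger in [G], so the
    index uses a count that the arm has really reached. *)
Lemma clique_time_le_triggers i n s :
  (clique_time H i n s <= triggers G i (rcons s i))%N.
Proof.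
have [_ HG] := GHC; rewrite triggers_rcons.
apply: leq_trans (clique_time_triggers _ _ _ _) (leq_trans _ (leq_addr _ _)).
by apply: sub_count => j /=; have := HG j i; case: (H j i); case: (G j i).
Qed.

Lemma round_regret_le t T q : (2 * k <= t)%N -> (t < T)%N -> 0 <= q <= 1 ->
  let s := arms t in let i := a (run mu G a t) in
  best_mu mu t.+1 - mu i (triggers G i (rcons s i))
    <= T%:R `^ q * max_gain mu q (clique_time H i (pulls i s).-1 s).
Proof.
move=> le_kt lt_tT q01; set s := arms t; set i := a _; rewrite /=.
have [HC _] := GHC; have Hrefl j := clique_partition_refl j HC.
have p2 j : (1 < pulls j s)%N by exact: pulls_gt1.
have szs : size s = t by exact: size_unzip1_run.
have x0 : (0 < clique_time H i (pulls i s).-1 s)%N.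
  by have := p2 i => ?; apply: clique_time_gt0 => //; lia.
have /andP[r0 _] := reward01 rise G_conn i s.
have g0 : 0 <= gain mu i (clique_time H i (pulls i s).-1 s) by exact: gain_ge0.
apply: (@le_trans _ _ ((T%:R * gain mu i (clique_time H i (pulls i s).-1 s)) `^ q)).
  apply: le_powR_min => //; first by rewrite mulr_ge0.
    by rewrite lerBlDr -[leLHS]addr0; apply: lerD => //; apply: best_mu_le1.
  apply: (@le_trans _ _ (t.+1%:R * gain mu i (clique_time H i (pulls i s).-1 s)));
    last by apply: ler_wpM2r => //; rewrite ler_nat.
  have := optimistic_index_le rise (Hrefl i) (p2 i)
            (clique_time_le_triggers i (pulls i s) s).
  rewrite szs; apply: le_trans; rewrite lerD2r.
  have idx_ge j := optimistic_index_ge rise (Hrefl j) (p2 j).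
  have [_] := alg (run mu G a t); rewrite size_run => /(_ le_kt) best.
  (* Each arm is below its own index, and the played arm has the largest index. *)
  have mu_le j : mu j t.+1 <= optimistic_index mu H s i.
    by apply: le_trans (best j); rewrite -{1}szs.
  (* The default 0 of the maximum must also lie below the index; a nonnegative reward ensures it. *)
  apply: bigmax_le => // ; apply: le_trans (mu_le i).
  by have [+ _ _] := rise => /(_ i t.+1 isT)/andP[].
rewrite powRM //; apply: ler_wpM2l; first exact: powR_ge0.
exact: (le_bigmax _ (fun j => gain mu j _ `^ q)).
Qed.

(** A pull of [i] after [N] earlier ones is charged to pull [N.-1]. Charging starts at [N = 2], so
    the charged indices run from 1 to the number of pulls minus 2. *)
Definition lagged_gains q s : R :=
  \sum_i \sum_(1 <= n < (pulls i s).-1) max_gain mu q (clique_time H i n s).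

Lemma lagged_gains_rcons q s i : (1 < pulls i s)%N ->
  lagged_gains q (rcons s i)
  = lagged_gains q s + max_gain mu q (clique_time H i (pulls i s).-1 s).
Proof.
move=> p2; rewrite /lagged_gains (bigD1 i) //= [in RHS](bigD1 i) //=.
rewrite pulls_rcons eqxx addn1 /= addrAC; congr (_ + _); last first.
  apply: eq_bigr => j; rewrite eq_sym => /negPf ne_ij.
  rewrite pulls_rcons ne_ij addn0; apply: eq_big_nat => n lt_n.
  by rewrite clique_time_rcons //; lia.
(* With two earlier pulls the range gains exactly the index [(pulls i s).-1]. *)
have ep : pulls i s = (pulls i s).-1.+1 by lia.
rewrite {1}ep big_nat_recr /=; last by lia.
congr (_ + _); last by rewrite clique_time_rcons //; lia.
by apply: eq_big_nat => n lt_n; rewrite clique_time_rcons //; lia.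
Qed.

(** Induction on the rounds after the round-robin phase, which costs at most [2 * k]. The horizon
    [T] stays fixed so that the factor is the same at every step. *)
Lemma run_regret_le t T q : (2 * k <= t <= T)%N -> 0 <= q <= 1 ->
  \sum_(1 <= n < t.+1) best_mu mu n - total_reward (run mu G a t)
    <= (2 * k)%:R + T%:R `^ q * lagged_gains q (arms t).
Proof.
move=> + q01; case/andP=> le_kt; rewrite -(subnKC le_kt).
elim: (t - 2 * k)%N => [|d IHd] le_T.
  rewrite addn0; apply: le_trans (run_regret_le_horizon (2 * k) a G_conn) _.
  rewrite lerDl mulr_ge0 ?powR_ge0 //.
  by do 2![apply: sumr_ge0 => ? _]; exact: max_gain_ge0.
rewrite addnS in le_T *; have IH := IHd (ltnW le_T).
have le_k : (2 * k <= 2 * k + d)%N by exact: leq_addr.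
have step := round_regret_le le_k le_T q01.
rewrite run_recr total_reward_observe unzip1_observe lagged_gains_rcons.
  rewrite big_nat_recr //= mulrDr addrA opprD addrACA.
  exact: lerD IH step.
exact: pulls_gt1.
Qed.

(** Group the arms by clique. The ceiling is the least [M] with [clique_pulls] at most [#|A| * M],
    as [sum_clique_time_le] requires. *)
Lemma lagged_gains_le q t : 0 <= q -> (2 * k <= t)%N ->
  lagged_gains q (arms t)
  <= \sum_(A in C) #|A|%:R * total_increment mu
       `|Num.ceil ((clique_pulls A (arms t))%:R / #|A|%:R : R)|%N q.
Proof.
move=> q0 le_kt; have [HC _] := GHC; have [partC _] := HC.
have -> : lagged_gains q (arms t)
    = \sum_(A in C) \sum_(i in A) \sum_(1 <= n < (pulls i (arms t)).-1)
        max_gain mu q (clique_time H i n (arms t)).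
  by rewrite -(set_partition_big _ partC); apply: eq_bigl => i; rewrite inE.
apply: ler_sum => A AC; have [_ _ C0] := and3P partC.
have A0 : (0 < #|A|)%N by rewrite card_gt0; apply: contraNneq C0 => <-.
have pA : (0 < clique_pulls A (arms t))%N.
  have /card_gt0P[i iA] := A0; rewrite /clique_pulls (bigD1 i) //=.
  by rewrite ltn_addr // ltnW // pulls_gt1.
have A0R : 0 < #|A|%:R :> R by rewrite ltr0n.
set x : R := _ / _; have x0 : 0 < x by rewrite divr_gt0 // ltr0n.
have cx : 0 < Num.ceil x by rewrite ceil_gt0.
have xM : x <= `|Num.ceil x|%N%:R.
  by rewrite natr_absz gtr0_norm // ceil_ge.
apply: (sum_clique_time_le (max_gain_ge0 mu q)
         (fun p n => max_gain_nonincreasing rise q0) HC AC) => //.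
- by move=> i _; exact: pulls_gt1.
- by rewrite absz_gt0 gt_eqF.
- by rewrite -(ler_nat R) natrM mulrC -ler_pdivrMr.
Qed.

Lemma regret_DR_G_UB_le T q : 0 <= q <= 1 ->
  regret mu G T (deterministic a) <= (2 * k)%:R + regret_bound mu C (arms T) q.
Proof.
move=> q01; have /andP[q0 _] := q01.
apply: le_trans (regret_le T a G_conn) _.
have U0 A : 0 <= total_increment mu
    `|Num.ceil ((clique_pulls A (arms T))%:R / #|A|%:R : R)|%N q.
  by apply: sumr_ge0 => n _; exact: max_gain_ge0.
have S2 : 0 <= \sum_(A in C) #|A|%:R * (clique_pulls A (arms T))%:R `^ (q / (1 + q))
    * total_increment mu
        `|Num.ceil ((clique_pulls A (arms T))%:R / #|A|%:R : R)|%N q `^ (1 + q)^-1.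
  by apply: sumr_ge0 => A _; rewrite !mulr_ge0 ?powR_ge0.
rewrite /regret_bound size_unzip1_run.
have [lt_Tk|le_kT] := ltnP T (2 * k).
  apply: le_trans (run_regret_le_horizon T a G_conn) _.
  rewrite -[leLHS]addr0; apply: lerD; first by rewrite ler_nat ltnW.
  rewrite addr_ge0 ?mulr_ge0 ?powR_ge0 //.
  by apply: sumr_ge0 => A _; rewrite mulr_ge0.
have le_kTT : (2 * k <= T <= T)%N by rewrite le_kT /=.
apply: le_trans (run_regret_le le_kTT q01) _.
rewrite lerD2l -[leLHS]addr0; apply: lerD => //.
by apply: ler_wpM2l; [exact: powR_ge0|exact: lagged_gains_le].
Qed.

End Algorithm.
End Policies.

(** * Passing to the infimum over [q] *)

Theorem theorem4 (R : realType) :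
  exists2 p : R, 0 <= p &
  forall k : nat, exists c : R,
  forall (mu : 'I_k -> nat -> R) (G GL : 'M[bool]_k) (CL : {set {set 'I_k}})
         (T : nat) (a : history R k -> 'I_k),
    rising_instance mu ->
    connectivity G ->
    maximal_block_submatrix G GL CL ->
    DR_G_UB mu GL a ->
    regret mu G T (deterministic a)
      <= c * (1 + ln T%:R) `^ p
           * (1 + inf [set regret_bound mu CL (unzip1 (run mu G a T)) q
                      | q in `[0, 1]]).
Proof.
exists 0 => // k; exists (2 * k)%:R => mu G GL CL T a rise G_conn [GHC _] alg.
(* The mere existence of the rule [a] provides an arm. *)
have k0 : (0 < k)%N := leq_ltn_trans (leq0n _) (ltn_ord (a [::])).
(* The additive [2 * k] is absorbed by the 1 next to the infimum. *)
rewrite powRr0 mulr1 mulrDr mulr1 -lerBlDl.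
set B := [set _ | _ in _]; have B0 : B !=set0.
  by exists (regret_bound mu CL (unzip1 (run mu G a T)) 0); exists 0 => //;
     rewrite /= in_itv /= lexx ler01.
have lb : lbound B (regret mu G T (deterministic a) - (2 * k)%:R).
  move=> _ [q + <-]; rewrite /= in_itv /= => q01.
  by rewrite lerBlDl (regret_DR_G_UB_le rise G_conn GHC alg).
have lb0 : lbound B 0.
  move=> _ [q _ <-]; have S A : 0 <= total_increment mu
      `|Num.ceil ((clique_pulls A (unzip1 (run mu G a T)))%:R / #|A|%:R : R)|%N q.
    by apply: sumr_ge0 => n _; exact: max_gain_ge0.
  rewrite addr_ge0 ?mulr_ge0 ?powR_ge0 // sumr_ge0 // => A _;
    by rewrite !mulr_ge0 ?powR_ge0.
apply: le_trans (lb_le_inf B0 lb) _.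
(* The infimum is nonnegative, so the factor [2 * k], at least 1, only enlarges it. *)
by apply: ler_peMl; [exact: lb_le_inf|rewrite ler1n; lia].
Qed.
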